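(* Let $p$ be an odd prime, $q=p^{n}$, and $F=\mathrm{GF}(q)=\{a_{0}=0,a_{1},\dots,a_{q-1}\}$. For $c\in F$ let $f_{c}:F\to F$, $f_{c}(x)=c+x^{2}$, and let $M(f_{c})$ be the $q\times q$ matrix over $F$, with rows and columns indexed by the elements of $F$, whose $(a,b)$ entry is $f_{c}(b-a)$. Let $H$ be the $q^{2}\times q^{2}$ block matrix $H=[H_{i,m}]_{0\le i,m\le q-1}$ whose $(i,m)$ block is $H_{i,m}=M(f_{a_{i}a_{m}})$ (so in particular the blocks in block-row $0$ and block-column $0$ are all $M(f_{0})$). Then $H$ is a $\mathrm{GH}(q,q)$ over the additive group of $F$.
   Context: For a finite additive abelian group $U$ of order $u$ and a positive integer $\lambda$, a generalized Hadamard matrix $\mathrm{GH}(u,\lambda)$ over $U$ is a square matrix $[d_{ij}]$ of order $u\lambda$ with entries in $U$ such that for any two distinct rows $i\neq \ell$, the multiset $\{d_{ij}-d_{\ell j}: 1\le j\le u\lambda\}$ contains each element of $U$ exactly $\lambda$ times. *)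

(* Defs.v *)
From mathcomp Require Import all_boot all_order all_fingroup all_algebra.

Set Implicit Arguments.
Unset Strict Implicit.
Unset Printing Implicit Defensive.

Import GRing.Theory.
Local Open Scope ring_scope.

(* The order N of D is a separate parameter, constrained by N = u * lambda, so
   that block matrices, whose dimension is the formal sum of the block sizes,
   can be used without a cast. *)
Definition is_GH (U : finZmodType) (u lambda N : nat) (D : 'M[U]_N) : Prop :=
  [/\ #|U| = u, (0 < lambda)%N, N = (u * lambda)%N &
      forall i l : 'I_N, i != l ->
        forall x : U, #|[set j : 'I_N | D i j - D l j == x]| = lambda].

Section Construction.
Variables (F : finFieldType) (q : nat) (a : 'I_q -> F).

Definition f_ (c x : F) : F := c + x ^+ 2.

(* a lists the elements of F; index s stands for the row or column a s. *)
Definition M_ (f : F -> F) : 'M[F]_q := \matrix_(s, t) f (a t - a s).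

Definition H_ : 'M[F]_(\sum_(i < q) q) :=
  \mxblock_(i < q, m < q) M_ (f_ (a i * a m)).

End Construction.

(* Main.v *)
Require Import Defs.
From mathcomp Require Import all_boot all_order all_fingroup all_algebra.
From mathcomp Require Import cyclic ring.
Import tagnat GRing.Theory.
Local Open Scope ring_scope.

(** After subtracting two rows of [H] the squares of the column variable cancel,
so the difference at column [(m, b)] is an affine form in [(a m, a b)], with
linear coefficients [a i - a l] and [2 (a t - a s)] for the rows [(i, s)] and
[(l, t)]. In odd characteristic distinct rows give a nonzero linear part, and
each value is then taken on a line of [F * F], i.e. exactly [q] times. *)

(** The order of the additive group kills 1; if 2 were zero, an odd multiple of 1 would be 1 itself,
    forcing 1 = 0. *)
Lemma two_neq0_odd_card (F : finFieldType) : odd #|F| -> 2%:R != 0 :> F.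
Proof.
move=> oddF; apply/negP => /eqP two0.
have : (1 : F) *+ #|F| = 0 by rewrite -FinRing.zmodXgE -cardsT expg_cardG ?inE.
rewrite -(odd_double_half #|F|) oddF -muln2 mulnC mulrnDr mulrnA two0 mul0rn.
by rewrite addr0 => /eqP; rewrite oner_eq0.
Qed.

(** A nonzero coefficient lets its coordinate be solved for, so the line is a graph over the other
    coordinate. *)
Lemma card_affine_line (F : finFieldType) (u v w : F) :
  (u != 0) || (v != 0) -> #|[set z : F * F | u * z.1 + v * z.2 == w]| = #|F|.
Proof.
case: (eqVneq u 0) => [-> /= v0 | u0 _].
  have -> : [set z : F * F | 0 * z.1 + v * z.2 == w]
          = [set (x, w / v) | x in [set: F]].
    apply/setP => -[x y]; rewrite !inE mul0r add0r; apply/eqP/imsetP.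
      by move=> /= <-; exists x; rewrite ?inE // mulrAC mulfV // mul1r.
    by case=> x' _ [_ ->] /=; rewrite mulrC divfK.
  by rewrite card_imset ?cardsT // => x x' [].
have -> : [set z : F * F | u * z.1 + v * z.2 == w]
        = [set ((w - v * y) / u, y) | y in [set: F]].
  apply/setP => -[x y]; rewrite !inE; apply/eqP/imsetP.
    by move=> /= <-; exists y; rewrite ?inE // addrK mulrAC mulfV // mul1r.
  by case=> y' _ [-> ->] /=; rewrite mulrC divfK // subrK.
by rewrite card_imset ?cardsT // => y y' [].
Qed.

(** Serves to index the columns of [H_] by points of the plane: block first, then position in the
    block. *)
Lemma sig_pair_bij (q : nat) (F : finFieldType) (a : 'I_q -> F) :
  bijective a ->
  bijective (fun j : 'I_(\sum_(i < q) q) => (a (sig1 j), a (sig2 j))).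
Proof.
case=> b ab ba.
exists (fun z : F * F => Rank (b z.1) (b z.2)) => [j | [x y]] /=.
  by rewrite !ab sig2K.
by congr (_, _); rewrite -[RHS]ba; congr (a _); rewrite /sig1 /sig2 rankK.
Qed.

Theorem theorem3p1 (p n q : nat) (F : finFieldType) (a : 'I_q -> F)
  (p_prime : prime p) (p_odd : odd p) (q_def : q = (p ^ n)%N)
  (card_F : #|F| = q) (a_bij : bijective a)
  (a0 : forall i : 'I_q, nat_of_ord i = 0%N -> a i = 0) :
  is_GH q q (H_ a).
Proof.
have a_inj := bij_inj a_bij.
have two0 : 2%:R != 0 :> F.
  by apply: two_neq0_odd_card; rewrite card_F q_def oddX p_odd orbT.
split=> // [||i l neq_il x].
- by rewrite q_def expn_gt0 prime_gt0.
- by rewrite sum_nat_const card_ord.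
set u := a (sig1 i) - a (sig1 l); set v := 2%:R * (a (sig2 l) - a (sig2 i)).
(* [w] is [x] less the constant term of the difference of the two squares. *)
set w := x - a (sig2 i) ^+ 2 + a (sig2 l) ^+ 2.
have uv0 : (u != 0) || (v != 0).
  rewrite mulf_eq0 (negPf two0) /= !subr_eq0 !(inj_eq a_inj) -negb_and.
  (* Were both coefficients zero, the two rows would share block and position. *)
  apply: contraNN neq_il => /andP[/eqP e1 /eqP e2].
  by apply/eqP/(bij_inj (sig_pair_bij _ _ _ a_bij)); rewrite e1 e2.
rewrite -[RHS]card_F -(card_affine_line _ _ _ w uv0).
rewrite -(on_card_preimset (onW_bij _ (sig_pair_bij _ _ _ a_bij))).
apply: eq_card => j; rewrite !inE !mxE /f_ -subr_eq0 -[RHS]subr_eq0 /=.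
by congr (_ == 0); rewrite /u /v /w; ring.
Qed.
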